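(* Assume that a channel $\{p(y_i|x^i,y^{i-1})\}_{i=1}^\infty$ with an independent additive noise feedback $Z_i=Y_i+V_i$ satisfies the strong converse property. Then a lower bound on the noisy feedback capacity is given by $$\underline C_{FB}^{noise}=\bar C_{FB}^{noise}-\bar h(V),\qquad \bar h(V)=\limsup_{n\rightarrow\infty}\frac1n H(V^n),$$ i.e. $C_{FB}^{noise}\ge \bar C_{FB}^{noise}-\bar h(V)$, where $$\bar C_{FB}^{noise}=\sup_X\liminf_{n\to\infty}\frac1n I(X^n\rightarrow Y^n|V^n)$$ and the supremum is taken over all possible channel input distributions $\{p(x_i|x^{i-1},z^{i-1})\}_{i=1}^\infty$ with $z^{i-1}=y^{i-1}+v^{i-1}$.
   Context: All alphabets are finite; $x^n=(x_1,\dots,x_n)$, $x^0=\emptyset$; logarithms are base 2. Independent additive noise feedback: $Z_i=Y_i+V_i$, where addition is in an abelian group containing the finite alphabets of $Y$ and $V$, and the noise process $\{V_i\}$ is independent of the message and of the channel: given all of the past (message, $X^i$, $Y^i$, $V^{i-1}$), $V_i$ has law $p(v_i|v^{i-1})$. Given the past, $Y_i$ has law $p(y_i|x^i,y^{i-1})$. A channel input distribution is a single infinite family $\{p(x_i|x^{i-1},z^{i-1})\}_{i=1}^\infty$; with the channel and the noise it determines, for every $n$, the joint law of $(X^n,Y^n,V^n)$ (order $X_1,Y_1,V_1,X_2,\dots$). $I(X^n\rightarrow Y^n|V^n)=\sum_{i=1}^n I(X^i;Y_i|Y^{i-1},V^n)$. Codes and capacity: a code-function is $f^n=(f_1,\dots,f_n)$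 with $f_i:\mathcal Z^{i-1}\to\mathcal X$; using $f^n$ means $X_i=f_i(Z^{i-1})$. An $(n,M,\epsilon)$ code consists of $M$ code-functions $\{f^n[w]\}_{w=1}^M$ and a decoder $g:\mathcal Y^n\to\{1,\dots,M\}$ with $\frac1M\sum_{w}\Pr(g(Y^n)\ne w|w)\le\epsilon$. $C_{FB}^{noise}$ is the supremum of the rates $R\ge0$ such that, for every $0<\epsilon<1$, for all sufficiently large $n$ there is an $(n,M,\epsilon)$ code with $\frac{\log M}{n}\ge R-\epsilon$. Strong converse property: for every $R>C_{FB}^{noise}$, every sequence of $(n,M_n,\epsilon_n)$ codes (with $\epsilon_n$ the average error probability) such that $\liminf_{n\to\infty}\frac1n\log M_n\ge R$ satisfies $\lim_{n\to\infty}\epsilon_n=1$. *)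

(* Defs.v *)
From mathcomp Require Import all_boot all_order all_algebra.
From mathcomp Require Import all_classical all_reals all_analysis.

Set Implicit Arguments.
Unset Strict Implicit.
Unset Printing Implicit Defensive.

Import Order.TTheory GRing.Theory Num.Theory.
Import numFieldNormedType.Exports.

Local Open Scope classical_set_scope.
Local Open Scope ring_scope.

Definition log2 (R : realType) (x : R) : R := ln x / ln 2.

Definition is_pmf (R : realType) (T : finType) (p : T -> R) : Prop :=
  (forall t, 0 <= p t) /\ \sum_t p t = 1.

Definition pr (R : realType) (Om : finType) (P : Om -> R) (E : pred Om) : R :=
  \sum_(w | E w) P w.

(* In the two definitions below, a term of probability 0 contributes 0. *)
Definition entropy (R : realType) (Om : finType) (P : Om -> R) : R :=
  - \sum_w P w * log2 (P w).

(* I(A; B | C), the random variables A, B, C being functions on (Om, P). *)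
Definition cond_mutual_info (R : realType) (Om TA TB TC : finType)
    (P : Om -> R) (A : Om -> TA) (B : Om -> TB) (C : Om -> TC) : R :=
  \sum_a \sum_b \sum_c
    let pabc := pr P (fun w => [&& A w == a, B w == b & C w == c]) in
    let pac := pr P (fun w => (A w == a) && (C w == c)) in
    let pbc := pr P (fun w => (B w == b) && (C w == c)) in
    let pc := pr P (fun w => C w == c) in
    pabc * log2 (pabc * pc / (pac * pbc)).

(* A family of conditional laws indexed by time is a single function on
   sequences, the time being read off from the length of the past:
     p(x_i | x^{i-1}, z^{i-1})  is  p xs zs x  with  size xs = size zs = i-1,
     p(y_i | x^i, y^{i-1})      is  W xs ys y  with  size xs = i, size ys = i-1,
     p(v_i | v^{i-1})           is  Q vs v     with  size vs = i-1.
   Values at other lengths are never used and are left unconstrained. *)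
Definition is_input (R : realType) (X : finType) (G : Type)
    (p : seq X -> seq G -> X -> R) : Prop :=
  forall xs zs, size xs = size zs -> is_pmf (p xs zs).

Definition is_channel (R : realType) (X Y : finType)
    (W : seq X -> seq Y -> Y -> R) : Prop :=
  forall xs ys, size xs = (size ys).+1 -> is_pmf (W xs ys).

Definition is_noise (R : realType) (V : finType)
    (Q : seq V -> V -> R) : Prop :=
  forall vs, is_pmf (Q vs).

(* The alphabets of Y and V sit in the group G through jY and jV. *)
Definition feedback (Y V : Type) (G : zmodType) (jY : Y -> G) (jV : V -> G)
    (ys : seq Y) (vs : seq V) : seq G :=
  [seq jY yv.1 + jV yv.2 | yv <- zip ys vs].

(* Indices start at 0: the ordinal i stands for time i + 1. *)
Definition joint_law (R : realType) (X Y V : finType) (G : zmodType)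
    (jY : Y -> G) (jV : V -> G) (W : seq X -> seq Y -> Y -> R)
    (Q : seq V -> V -> R) (p : seq X -> seq G -> X -> R) (n : nat)
    (w : n.-tuple X * n.-tuple Y * n.-tuple V) : R :=
  let: (x, y, v) := w in
  \prod_(i < n)
    (p (take i x) (feedback jY jV (take i y) (take i v)) (tnth x i)
     * W (take i.+1 x) (take i y) (tnth y i)
     * Q (take i v) (tnth v i)).

Definition noise_law (R : realType) (V : finType) (Q : seq V -> V -> R)
    (n : nat) (v : n.-tuple V) : R :=
  \prod_(i < n) Q (take i v) (tnth v i).

Definition directed_info (R : realType) (X Y V : finType) (G : zmodType)
    (jY : Y -> G) (jV : V -> G) (W : seq X -> seq Y -> Y -> R)
    (Q : seq V -> V -> R) (p : seq X -> seq G -> X -> R) (n : nat) : R :=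
  \sum_(i < n)
    cond_mutual_info (@joint_law R X Y V G jY jV W Q p n)
      (fun w => [tuple of take i.+1 w.1.1])
      (fun w => tnth w.1.2 i)
      (fun w => ([tuple of take i w.1.2], w.2)).

(* A code-function f^n = (f_1, .., f_n) is a function f : seq G -> X with
   f_i(z^{i-1}) = f z^{i-1}; only its values at lengths < n and at sequences
   in the (finite) range of the feedback matter. *)
Record code (X Y : finType) (G : zmodType) (n M : nat) := Code {
  code_fun : 'I_M -> seq G -> X;
  decoder : n.-tuple Y -> 'I_M
}.

Definition input_of_code_fun (R : realType) (X : finType) (G : Type)
    (f : seq G -> X) : seq X -> seq G -> X -> R :=
  fun _ zs x => (x == f zs)%:R.

Definition avg_error (R : realType) (X Y V : finType) (G : zmodType)
    (jY : Y -> G) (jV : V -> G) (W : seq X -> seq Y -> Y -> R)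
    (Q : seq V -> V -> R) (n M : nat) (c : code X Y G n M) : R :=
  M%:R^-1 * \sum_(m < M)
    pr (@joint_law R X Y V G jY jV W Q (input_of_code_fun R (code_fun c m)) n)
       (fun w => decoder c w.1.2 != m).

Definition achievable (R : realType) (X Y V : finType) (G : zmodType)
    (jY : Y -> G) (jV : V -> G) (W : seq X -> seq Y -> Y -> R)
    (Q : seq V -> V -> R) (r : R) : Prop :=
  0 <= r /\
  forall eps : R, 0 < eps < 1 ->
    \forall n \near \oo, exists (M : nat) (c : code X Y G n M),
      avg_error jY jV W Q c <= eps /\ r - eps <= log2 M%:R / n%:R.

Definition capacity (R : realType) (X Y V : finType) (G : zmodType)
    (jY : Y -> G) (jV : V -> G) (W : seq X -> seq Y -> Y -> R)
    (Q : seq V -> V -> R) : \bar R :=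
  ereal_sup [set r%:E | r in [set r : R | achievable jY jV W Q r]].

Definition strong_converse (R : realType) (X Y V : finType) (G : zmodType)
    (jY : Y -> G) (jV : V -> G) (W : seq X -> seq Y -> Y -> R)
    (Q : seq V -> V -> R) : Prop :=
  forall r : R, (capacity jY jV W Q < r%:E)%E ->
  forall (M : nat -> nat) (c : forall n, code X Y G n (M n)),
    (r%:E <= limn_einf (fun n => (n%:R^-1 * log2 (M n)%:R)%:E))%E ->
    (fun n => avg_error jY jV W Q (c n)) @ \oo --> (1 : R).

Definition capacity_bar (R : realType) (X Y V : finType) (G : zmodType)
    (jY : Y -> G) (jV : V -> G) (W : seq X -> seq Y -> Y -> R)
    (Q : seq V -> V -> R) : \bar R :=
  ereal_sup
    [set limn_einf (fun n => (n%:R^-1 * directed_info jY jV W Q p n)%:E)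
    | p in [set p : seq X -> seq G -> X -> R | is_input p]].

Definition noise_entropy_rate (R : realType) (V : finType)
    (Q : seq V -> V -> R) : \bar R :=
  limn_esup (fun n => (n%:R^-1 * entropy (@noise_law R V Q n))%:E).

(* Main.v *)
Require Import Defs.
From mathcomp Require Import all_boot all_order all_algebra.
From mathcomp Require Import all_classical all_reals all_analysis.
From mathcomp Require Import ring lra.

(** Let F be a random code-function inducing a given input law. The directed
    information I(X^n -> Y^n | V^n) is I(F; Y^n, V^n), which is at most
    I(F; Y^n) + H(V^n). If I(F; Y^n) / n stayed above C + 3 d, then the
    information density of (F, Y^n) would exceed n (C + 2 d) with probability
    bounded away from 0, because the alphabet of Y is finite; Feinstein's greedy
    selection would then give codes of rate C + d whose error is bounded away
    from 1, against the strong converse. *)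

Set Implicit Arguments.
Unset Strict Implicit.
Unset Printing Implicit Defensive.

Import Order.TTheory GRing.Theory Num.Theory.
Import numFieldNormedType.Exports.

Local Open Scope classical_set_scope.
Local Open Scope ring_scope.

(** * Finite probability and one-shot channel coding *)

Section Logarithm.
Variable R : realType.
Implicit Types x y : R.

(** Nothing makes the information density concentrate around its mean, so a large I(F; Y^n) yields
    only codes whose success probability stays above a positive constant. The strong converse
    excludes even these above capacity. The loss H(V^n) arises because the decoder sees Y^n but not
    V^n. The other obstacle is that an input law looks at past inputs and feedback, whereas a
    code-function sees feedback only: F is built by drawing an independent input for every possible
    history, after which the inputs are determined by the feedback and can be recomputed from it. *)

Lemma ln_le_subr1 x : 0 < x -> ln x <= x - 1.
Proof. by move=> x0; have := @le_ln1Dx R (x - 1); rewrite subrKC; apply; lra. Qed.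

(** Gibbs' inequality: [ln x <= x - 1] at [x = q t / p t] bounds each term by [q t - p t]. *)
Lemma sum_mul_ln_ratio_le0 (T : finType) (p q : T -> R) :
  (forall t, 0 <= p t) -> (forall t, 0 <= q t) ->
  (forall t, 0 < p t -> 0 < q t) -> \sum_t q t <= \sum_t p t ->
  \sum_t p t * ln (q t / p t) <= 0.
Proof.
move=> p0 q0 pq qp; apply: (@le_trans _ _ (\sum_t (q t - p t))); last first.
  by rewrite big_split/= sumrN subr_le0.
apply: ler_sum => t _; have := p0 t; rewrite le_eqVlt => /predU1P[<-|pt].
  by rewrite mul0r subr0.
have -> : q t - p t = p t * (q t / p t - 1) by field; rewrite gt_eqF.
by rewrite ler_pM2l// ln_le_subr1// divr_gt0// pq.
Qed.

Lemma ln2_gt0 : 0 < ln 2 :> R.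
Proof. by rewrite ln_gt0// ltr1n. Qed.

End Logarithm.

Section FiniteProbability.
Variables (R : realType) (Om : finType) (P : Om -> R).

Lemma pr_ge0 (E : pred Om) : (forall w, 0 <= P w) -> 0 <= pr P E.
Proof. by move=> P0; apply: sumr_ge0. Qed.

Lemma pr_le (E E' : pred Om) : (forall w, 0 <= P w) ->
  (forall w, E w -> E' w) -> pr P E <= pr P E'.
Proof.
move=> P0 EE'; rewrite /pr [leRHS](bigID E)/= -[leLHS]addr0 lerD//.
  rewrite le_eqVlt; apply/orP; left; apply/eqP/eq_bigl => w.
  by case Ew : (E w); rewrite ?andbT ?andbF// EE'.
exact: sumr_ge0.
Qed.

Lemma pr_gt0 (E : pred Om) w : (forall w, 0 <= P w) ->
  0 < P w -> E w -> 0 < pr P E.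
Proof.
move=> P0 Pw Ew; rewrite /pr (bigD1 w)//= ltr_pwDl// sumr_ge0//.
Qed.

Lemma sum_pr_fiber (T : finType) (f : Om -> T) (g : T -> R) :
  \sum_w P w * g (f w) = \sum_t pr P (fun w => f w == t) * g t.
Proof.
rewrite (partition_big f xpredT)//=; apply: eq_bigr => t _.
by rewrite /pr mulr_suml; apply: eq_bigr => w /eqP ->.
Qed.

Lemma sum_pr (T : finType) (f : Om -> T) :
  \sum_t pr P (fun w => f w == t) = \sum_w P w.
Proof.
have := sum_pr_fiber f (fun=> 1); under eq_bigr do rewrite mulr1.
by move=> ->; under [RHS]eq_bigr do rewrite mulr1.
Qed.

Lemma pr_preim (T : finType) (f : Om -> T) (E : pred T) :
  pr P (fun w => E (f w)) = \sum_(t | E t) pr P (fun w => f w == t).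
Proof.
rewrite /pr (partition_big f E)//=; apply: eq_bigr => t Et; apply: eq_bigl => w.
by case: eqP => [->|]; rewrite ?Et ?andbF.
Qed.

(** As the mean of a density over outcomes, the information can be handled pointwise, at outcomes of
    positive probability, where every logarithm has a positive argument. *)
Lemma cond_mutual_info_expect (TA TB TC : finType)
    (A : Om -> TA) (B : Om -> TB) (C : Om -> TC) :
  cond_mutual_info P A B C =
  \sum_w P w * log2
    (pr P (fun w' => [&& A w' == A w, B w' == B w & C w' == C w]) *
     pr P (fun w' => C w' == C w) /
     (pr P (fun w' => (A w' == A w) && (C w' == C w)) *
      pr P (fun w' => (B w' == B w) && (C w' == C w)))).
Proof.
rewrite [RHS](partition_big A xpredT)//=; apply: eq_bigr => a _.
rewrite [RHS](partition_big B xpredT)//=; apply: eq_bigr => b _.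
rewrite [RHS](partition_big C xpredT)//=; apply: eq_bigr => c _.
rewrite {1}/pr mulr_suml; apply: eq_big => [w|w /and3P[/eqP-> /eqP-> /eqP->]//].
by rewrite andbA.
Qed.

End FiniteProbability.

(** * Information density and Feinstein's selection for a finite channel *)

Section FiniteChannel.
Variables (R : realType) (U Y : finType).
Variables (mu : U -> R) (k : U -> Y -> R).
Hypotheses (mu_pmf : is_pmf mu) (k_pmf : forall u, is_pmf (k u)).

Let mu_ge0 u : 0 <= mu u. Proof. exact: mu_pmf.1. Qed.
Let k_ge0 u y : 0 <= k u y. Proof. exact: (k_pmf u).1. Qed.

Definition output y := \sum_u mu u * k u y.

(* The information density of (u, y) exceeds [ln T]. *)
Definition dense (T : R) u y := T * output y < k u y.

Definition pr_dense T := \sum_u mu u * \sum_(y | dense T u y) k u y.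

Lemma output_gt0 u y : 0 < mu u -> 0 < k u y -> 0 < output y.
Proof.
move=> u0 k0; rewrite /output (bigD1 u)//= ltr_pwDl// ?mulr_gt0//.
by apply: sumr_ge0 => v _; rewrite mulr_ge0.
Qed.

Lemma pr_dense_ge0 T : 0 <= pr_dense T.
Proof. by apply: sumr_ge0 => u _; rewrite mulr_ge0// sumr_ge0. Qed.

(** Off the dense pairs the density is at most [ln T]. On them it is at most [- ln (output y)],
    which is unbounded, so [output] is compared with the uniform law: [- ln (output y) <= ln #|Y| +
    1 / (#|Y| * output y)]. The mean of the last term is at most 1. *)
Lemma mutual_info_le T : 1 <= T ->
  \sum_u mu u * \sum_y k u y * ln (k u y / output y) <=
  ln T + pr_dense T * ln #|Y|%:R + 1.
Proof.
move=> T1; have T0 : 0 < T by rewrite (lt_le_trans _ T1).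
have termle u y : 0 < mu u ->
    k u y * ln (k u y / output y) <=
    k u y * ln T + (if dense T u y then k u y else 0) * ln #|Y|%:R
      + k u y / (#|Y|%:R * output y).
  move=> u0; have := k_ge0 u y; rewrite le_eqVlt => /predU1P[<-|kuy].
    by rewrite !mul0r if_same mul0r !addr0.
  have Oy := output_gt0 u0 kuy.
  have N0 : 0 < #|Y|%:R :> R by rewrite ltr0n; apply/card_gt0P; exists y.
  case: ifPn => [_|]; last first.
    rewrite /dense -leNgt => kT; rewrite mul0r addr0 -[leLHS]addr0 lerD//.
      rewrite ler_pM2l// ler_ln ?posrE ?divr_gt0//.
      by rewrite ler_pdivrMr.
    by rewrite divr_ge0// ltW// mulr_gt0.
  rewrite -!mulrDr ler_pM2l//.
  have k1 : k u y <= 1.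
    rewrite -(k_pmf u).2 (bigD1 y)//= lerDl; exact: sumr_ge0.
  have l1 : ln (k u y / output y) <= - ln (output y).
    rewrite ln_div ?posrE//; have := ln_le0 k1; lra.
  have := @ln_le_subr1 R (#|Y|%:R * output y)^-1.
  rewrite invr_gt0 mulr_gt0// => /(_ isT).
  rewrite lnV ?posrE ?mulr_gt0// lnM ?posrE// => l2.
  have := ln_ge0 T1; lra.
apply: (@le_trans _ _ (\sum_u mu u * \sum_y
  (k u y * ln T + (if dense T u y then k u y else 0) * ln #|Y|%:R
      + k u y / (#|Y|%:R * output y)))).
  apply: ler_sum => u _; have := mu_ge0 u; rewrite le_eqVlt => /predU1P[<-|u0].
    by rewrite !mul0r.
  by rewrite ler_pM2l//; apply: ler_sum => y _; exact: termle.
under eq_bigr do rewrite !big_split/= -!mulr_suml (k_pmf _).2 mul1r -big_mkcond/=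
  !mulrDr mulrA.
rewrite !big_split/= -!mulr_suml mu_pmf.2 mul1r lerD//.
under eq_bigr do rewrite mulr_sumr.
rewrite exchange_big/=; apply: (@le_trans _ _ (\sum_(y : Y) (#|Y|%:R)^-1)).
  apply: ler_sum => y _; under eq_bigr do rewrite mulrA.
  rewrite -mulr_suml -/(output y); have [->|Oy] := eqVneq (output y) 0.
    by rewrite mul0r invr_ge0.
  by rewrite invfM mulrCA mulfV// mulr1.
have [Y0|Y0] := eqVneq #|Y| 0%N; rewrite sumr_const.
  by rewrite Y0 mulr0n.
by rewrite -[leLHS]mulr_natl mulfV// pnatr_eq0.
Qed.

(* Feinstein's greedy choice: while [m / T + b <= pr_dense T], the outputs
   already claimed by [m] codewords have probability at most [m / T], so some
   codeword keeps probability [b] of a dense, unclaimed output. *)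
Lemma dense_code T b m : 0 < T -> m%:R / T + b <= pr_dense T ->
  exists (s : nat -> U) (g : Y -> nat),
    (forall y, (g y < m)%N -> dense T (s (g y)) y) /\
    forall i, (i < m)%N -> b <= \sum_(y | g y == i) k (s i) y.
Proof.
move=> T0; have [u0] : exists u : U, true.
  have : \sum_u mu u != 0 by rewrite mu_pmf.2 oner_neq0.
  move=> h; case: (pickP (@predT U)) => [u _|E]; first by exists u.
  by move: h; rewrite big_pred0// eqxx.
move=> _; elim: m => [|m IHm] hm.
  by exists (fun=> u0), (fun=> 0%N); split.
have [|s [g [gd gb]]] := IHm.
  apply: le_trans hm; rewrite lerD2r ler_pdivrMr// divfK ?gt_eqF//.
  by rewrite ler_nat.
(* On the region of codeword [i], density gives [T * output y < k (s i) y], and the right-hand sides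
   sum to at most 1. *)
have claimed : \sum_(y | (g y < m)%N) output y <= m%:R / T.
  rewrite ler_pdivlMr// mulr_suml.
  rewrite (partition_big (fun y => inord (g y) : 'I_m.+1) (fun i => (i < m)%N))/=;
    last by move=> y gy; rewrite inordK// ltnW.
  apply: (@le_trans _ _ (\sum_(i < m.+1 | (i < m)%N) (1 : R))).
    apply: ler_sum => i im; rewrite -(k_pmf (s i)).2.
    rewrite [leRHS](bigID (fun y => (g y < m)%N && (inord (g y) == i)))/=.
    rewrite -[leLHS]addr0 lerD ?sumr_ge0//.
    apply: ler_sum => y /andP[gy /eqP gi].
    have {gi} gi : g y = i by rewrite -gi inordK// ltnW.
    by have := gd _ gy; rewrite /dense gi mulrC => /ltW.
  rewrite big_mkcond big_ord_recr/= ltnn addr0.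
  by under eq_bigr => i _ do rewrite ltn_ord; rewrite sumr_const card_ord.
(* Otherwise, averaging over [u] and splitting off the claimed outputs would give
   [pr_dense T <= b + m / T]. *)
have [u ub] : exists u, b <= \sum_(y | dense T u y && (m <= g y)%N) k u y.
  apply: contrapT => /forallNP nb.
  suff : pr_dense T < m.+1%:R / T + b by rewrite ltNge hm.
  apply: (@le_lt_trans _ _ (b + \sum_(y | (g y < m)%N) output y)).
    rewrite /pr_dense /output exchange_big/= -[b]mul1r -mu_pmf.2 mulr_suml -big_split/=.
    apply: ler_sum => u _; rewrite -mulr_sumr -mulrDr ler_wpM2l//.
    rewrite (bigID (fun y => (g y < m)%N))/= addrC lerD//.
      move: (nb u) => /negP; rewrite -ltNge => /ltW.
      by under [X in X <= _ -> _]eq_bigl do rewrite leqNgt.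
    rewrite [leRHS](bigID (fun y => dense T u y))/=.
    rewrite -[leLHS]addr0 lerD ?sumr_ge0//.
    by under eq_bigl do rewrite andbC.
  rewrite addrC ltrD2r (le_lt_trans claimed)//.
  by rewrite ltr_pM2r ?invr_gt0// ltr_nat.
(* A value of [g] not below the number of codewords means unclaimed. As [m] now names the new
   codeword, the remaining unclaimed outputs move to [m.+1]. *)
exists (fun i => if i == m then u else s i),
  (fun y => if (g y < m)%N then g y else if dense T u y then m else m.+1).
split=> [y|i].
  case: ifPn => [gy _|_].
    by rewrite ltn_eqF//; exact: gd.
  by case: ifPn => [d _|_]; rewrite ?eqxx// ltnn.
rewrite ltnS leq_eqVlt => /predU1P[->|im].
  rewrite eqxx; apply: (le_trans ub); rewrite le_eqVlt; apply/orP; left.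
  apply/eqP/eq_bigl => y; rewrite leqNgt; case: ifPn => [gy|_].
    by rewrite andbF; apply/esym/negbTE; rewrite neq_ltn gy.
  by rewrite andbT; case: ifPn => _; rewrite ?eqxx// gtn_eqF.
rewrite ltn_eqF//; apply: (le_trans (gb _ im)); rewrite le_eqVlt; apply/orP; left.
apply/eqP/eq_bigl => y; case: ifPn => // gy.
rewrite [LHS]gtn_eqF ?(leq_trans im) 1?leqNgt//.
by case: ifP => _; rewrite gtn_eqF// ltnW.
Qed.

End FiniteChannel.

(** * Laws of sequences and directed information *)

Section SequentialLaw.
Variables (R : realType) (A : finType) (q : seq A -> A -> R).

Fixpoint seq_law (past s : seq A) : R :=
  if s is a :: s' then q past a * seq_law (rcons past a) s' else 1.

Lemma seq_lawE past n (t : n.-tuple A) :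
  \prod_(i < n) q (past ++ take i t) (tnth t i) = seq_law past t.
Proof.
elim: n past t => [|n IHn] past t; first by rewrite big_ord0 tuple0.
case/tupleP: t => a t; rewrite big_ord_recl/= cats0 tnth0; congr (_ * _).
rewrite -IHn; apply: eq_bigr => i _.
by rewrite cat_rcons tnthS.
Qed.

Lemma seq_law_rcons past s a :
  seq_law past (rcons s a) = seq_law past s * q (past ++ s) a.
Proof.
elim: s past => [|b s IHs] past /=; first by rewrite mulr1 mul1r cats0.
by rewrite IHs mulrA cat_rcons.
Qed.

Lemma sum_cons_tuple n (P : pred (n.+1.-tuple A)) (F : n.+1.-tuple A -> R) :
  \sum_(t | P t) F t =
  \sum_a \sum_(t : n.-tuple A | P [tuple of a :: t]) F [tuple of a :: t].
Proof.
rewrite pair_big_dep/= (reindex (fun at_ : A * n.-tuple A => [tuple of at_.1 :: at_.2]))//=.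
exists (fun t => (thead t, [tuple of behead t])) => [[a t] _|t _] /=.
  by congr (_, _); apply: val_inj.
by rewrite -tuple_eta.
Qed.

(** The steps after the prefix sum to 1, from the last one backwards. Normalisation is required only
    below [N] because [is_input] constrains [p] only on pasts of equal lengths, which the kernel
    [step_law v] supplies as long as the noise word lasts. *)
Lemma sum_seq_law N past s n :
  (forall s', (size s' < N)%N -> \sum_a q s' a = 1) ->
  (size s <= n)%N -> (size past + n <= N)%N ->
  \sum_(t : n.-tuple A | take (size s) t == s) seq_law past t = seq_law past s.
Proof.
move=> q1; elim: n past s => [|n IHn] past s.
  rewrite leqn0 => /nilP -> _; rewrite (big_pred1 [tuple])//= => t.
  by rewrite tuple0/= eqxx; apply/esym/eqP/val_inj.
move=> sn pN; rewrite sum_cons_tuple; case: s sn => [_|b s sn] /=.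
  have pN' : (size past < N)%N by rewrite (leq_trans _ pN)// addnS ltnS leq_addr.
  rewrite -[RHS](q1 past)//; apply: eq_bigr => a _.
  rewrite -big_distrr/= -[RHS]mulr1; congr (_ * _).
  have := IHn (rcons past a) [::] isT; rewrite size_rcons addSn -addnS => /(_ pN) /= <-.
  by apply: eq_bigl => t; rewrite ?take0 ?eqxx.
rewrite (bigD1 b)//= [X in _ + X]big1 ?addr0 => [|a ab]; last first.
  by rewrite big_pred0// => t; rewrite eqseq_cons (negbTE ab).
rewrite -big_distrr/= -(IHn _ s)//; last by rewrite size_rcons addSn -addnS.
by congr (_ * _); apply: eq_bigl => t; rewrite eqseq_cons eqxx.
Qed.

End SequentialLaw.

(** * Joint law of inputs, outputs and noise; causality and the chain rule *)

Section JointLaw.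
Variables (R : realType) (X Y V : finType) (G : zmodType).
Variables (jY : Y -> G) (jV : V -> G).
Variables (W : seq X -> seq Y -> Y -> R) (Q : seq V -> V -> R).
Variable (p : seq X -> seq G -> X -> R).
Hypotheses (W_channel : is_channel W) (Q_noise : is_noise Q) (p_input : is_input p).
Variable n : nat.

Notation J := (@joint_law R X Y V G jY jV W Q p n).

(** The noise evolves independently of inputs and outputs, so conditioning on the whole word [v]
    leaves the pairs (X_i, Y_i) a sequential process with this kernel. *)
Definition step_law (v : seq V) (s : seq (X * Y)) (a : X * Y) : R :=
  p (unzip1 s) (feedback jY jV (unzip2 s) (take (size s) v)) a.1 *
  W (rcons (unzip1 s) a.1) (unzip2 s) a.2.

Lemma size_feedback ys vs : size (feedback jY jV ys vs) = minn (size ys) (size vs).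
Proof. by rewrite size_map size_zip. Qed.

Lemma noise_law_pmf : is_pmf (@noise_law R V Q n).
Proof.
split=> [v|]; first by apply: prodr_ge0 => i _; exact: (Q_noise _).1.
rewrite /noise_law; under eq_bigr do rewrite (seq_lawE _ [::]).
have := @sum_seq_law R V Q n [::] [::] n; rewrite add0n /= => <- //.
  by apply: eq_bigl => v; rewrite take0 eqxx.
by move=> s _; exact: (Q_noise _).2.
Qed.

Lemma input_ge0 (xs : seq X) (zs : seq G) x : size xs = size zs -> 0 <= p xs zs x.
Proof. by move=> s; exact: (p_input s).1. Qed.

Lemma step_sum1 (v : n.-tuple V) s : (size s < n)%N -> \sum_a step_law v s a = 1.
Proof.
move=> sn; have sfb : size (unzip1 s) = size (feedback jY jV (unzip2 s) (take (size s) v)).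
  by rewrite size_feedback size_take size_tuple sn !size_map minnn.
rewrite -(pair_bigA _ (fun x y => step_law v s (x, y)))/= -(p_input sfb).2.
apply: eq_bigr => x _; rewrite /step_law /= -mulr_sumr (W_channel _).2 ?mulr1//.
by rewrite size_rcons !size_map.
Qed.

Lemma joint_lawE (x : n.-tuple X) (y : n.-tuple Y) (v : n.-tuple V) :
  J (x, y, v) = noise_law Q v * seq_law (step_law v) [::] (zip x y).
Proof.
rewrite -(seq_lawE (step_law v) [::] [tuple of zip x y]) /noise_law -big_split/=.
apply: eq_bigr => i _; rewrite mulrC; congr (_ * _).
have zE : tnth [tuple of zip x y] i = (tnth x i, tnth y i).
  by rewrite (tnth_nth (tnth x i, tnth y i)) nth_zip ?size_tuple// -!tnth_nth.
have t1 : unzip1 (take i (zip x y)) = take i x.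
  by rewrite /unzip1 map_take -/(unzip1 _) unzip1_zip// !size_tuple.
have t2 : unzip2 (take i (zip x y)) = take i y.
  by rewrite /unzip2 map_take -/(unzip2 _) unzip2_zip// !size_tuple.
have sz : size (take i (zip x y)) = i.
  by rewrite size_take size_zip !size_tuple minnn ltn_ord.
rewrite /step_law zE/= t1 t2 sz.
by rewrite [take i.+1 x](take_nth (tnth x i)) ?size_tuple// -tnth_nth.
Qed.

Lemma joint_law_ge0 w : 0 <= J w.
Proof.
case: w => [[x y] v]; rewrite /joint_law; apply: prodr_ge0 => i _.
rewrite !mulr_ge0//.
- apply: input_ge0.
  by rewrite size_feedback !size_take !size_tuple ltn_ord minnn.
- by apply: (W_channel _).1; rewrite !size_takel ?size_tuple// ltnW.
- exact: (Q_noise _).1.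
Qed.

Lemma pr_joint_fix_noise (E : pred (n.-tuple X * n.-tuple Y)) (v : n.-tuple V) :
  pr J (fun w => E w.1 && (w.2 == v)) =
  noise_law Q v * \sum_(xy | E xy) seq_law (step_law v) [::] (zip xy.1 xy.2).
Proof.
transitivity (\sum_(xy | E xy) \sum_(v' | v' == v) J (xy, v')).
  by rewrite pair_big_dep; apply: eq_bigr => -[].
rewrite mulr_sumr; apply: eq_bigr => -[x y] _.
by rewrite big_pred1_eq joint_lawE.
Qed.

Lemma sum_pair_tuple (E : pred (n.-tuple X * n.-tuple Y))
    (F : n.-tuple X * n.-tuple Y -> R) :
  \sum_(xy | E xy) F xy =
  \sum_(t : n.-tuple (X * Y) | E ([tuple of unzip1 t], [tuple of unzip2 t]))
     F ([tuple of unzip1 t], [tuple of unzip2 t]).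
Proof.
rewrite (reindex (fun t : n.-tuple (X * Y) => ([tuple of unzip1 t], [tuple of unzip2 t])))//.
exists (fun xy : n.-tuple X * n.-tuple Y => [tuple of zip xy.1 xy.2]) => [t _|[x y] _].
  by apply: val_inj; rewrite /= zip_unzip.
by congr (_, _); apply: val_inj; rewrite /= ?unzip1_zip ?unzip2_zip// !size_tuple.
Qed.

Lemma pr_joint_prefix m (a : seq X) (b : seq Y) (v : n.-tuple V) :
  size a = m -> size b = m -> (m <= n)%N ->
  pr J (fun w => [&& take m w.1.1 == a, take m w.1.2 == b & w.2 == v]) =
  noise_law Q v * seq_law (step_law v) [::] (zip a b).
Proof.
move=> am bm mn.
transitivity (pr J (fun w => ((take m w.1.1 == a) && (take m w.1.2 == b)) && (w.2 == v))).
  by apply: eq_bigl => w; rewrite andbA.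
rewrite (pr_joint_fix_noise (fun xy => (take m xy.1 == a) && (take m xy.2 == b))).
congr (_ * _); rewrite sum_pair_tuple/=.
have szm : size (zip a b) = m by rewrite size_zip am bm minnn.
rewrite -(@sum_seq_law R _ (step_law v) n [::] (zip a b) n) ?szm//; last exact: step_sum1.
apply: eq_big => [t|t _]; last by rewrite zip_unzip.
rewrite -!map_take; apply/andP/eqP => [[/eqP e1 /eqP e2]|->].
  by rewrite -[LHS]zip_unzip /unzip1 /unzip2 e1 e2.
by rewrite -/(unzip1 _) -/(unzip2 _) unzip1_zip ?unzip2_zip ?am ?bm.
Qed.

Lemma joint_law_sum1 : \sum_w J w = 1.
Proof.
rewrite -(sum_pr _ (fun w => w.2)) -noise_law_pmf.2; apply: eq_bigr => v _.
rewrite -[RHS]mulr1 -(@pr_joint_prefix 0 [::] [::])//; apply: eq_bigl => w.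
by rewrite !take0.
Qed.

Lemma joint_law_pmf : is_pmf J.
Proof. by split; [exact: joint_law_ge0|exact: joint_law_sum1]. Qed.

Lemma pr_joint_noise (v : n.-tuple V) : pr J (fun w => w.2 == v) = noise_law Q v.
Proof.
rewrite -[RHS]mulr1 -(@pr_joint_prefix 0 [::] [::])//; apply: eq_bigl => w.
by rewrite !take0.
Qed.

Section Causality.
Variables (x : n.-tuple X) (y : n.-tuple Y) (v : n.-tuple V) (i : 'I_n).

Let takeS (T : Type) (t : n.-tuple T) : take i.+1 t = rcons (take i t) (tnth t i).
Proof. by rewrite (take_nth (tnth t i)) ?size_tuple// -tnth_nth. Qed.

Let eq_take (T : eqType) m (t t' : n.-tuple T) :
  ([tuple of take m t] == [tuple of take m t']) = (take m t == take m t').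
Proof. by []. Qed.

Let size_takei (T : Type) (t : n.-tuple T) : size (take i t) = i.
Proof. by rewrite size_take size_tuple ltn_ord. Qed.

Let Wi := W (take i.+1 x) (take i y) (tnth y i).

Let pr_step b :
  pr J (fun w => [&& take i.+1 w.1.1 == take i.+1 x,
                     take i.+1 w.1.2 == rcons (take i y) b & w.2 == v]) =
  noise_law Q v * seq_law (step_law v) [::] (zip (take i x) (take i y)) *
  (p (take i x) (feedback jY jV (take i y) (take i v)) (tnth x i) *
   W (take i.+1 x) (take i y) b).
Proof.
rewrite (@pr_joint_prefix i.+1) ?takeS ?size_rcons ?size_takei//.
rewrite zip_rcons ?size_takei// seq_law_rcons mulrA /step_law/=.
by rewrite unzip1_zip ?unzip2_zip ?size_takei// size_zip !size_takei minnn.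
Qed.

(** Causality: given the inputs so far, the past outputs and the whole noise word, the current
    output still has law [W]; future noise in the conditioning changes nothing. The product form
    also covers null events. *)
Lemma pr_joint_output_step :
  pr J (fun w => [&& [tuple of take i.+1 w.1.1] == [tuple of take i.+1 x],
                     tnth w.1.2 i == tnth y i &
                     ([tuple of take i w.1.2], w.2) == ([tuple of take i y], v)]) =
  pr J (fun w => ([tuple of take i.+1 w.1.1] == [tuple of take i.+1 x]) &&
                 (([tuple of take i w.1.2], w.2) == ([tuple of take i y], v))) * Wi.
Proof.
have splitE b (w : n.-tuple X * n.-tuple Y * n.-tuple V) :
  [&& take i.+1 w.1.1 == take i.+1 x, take i.+1 w.1.2 == rcons (take i y) b & w.2 == v] =
  [&& [tuple of take i.+1 w.1.1] == [tuple of take i.+1 x], tnth w.1.2 i == b &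
      ([tuple of take i w.1.2], w.2) == ([tuple of take i y], v)].
  rewrite xpair_eqE !eq_take (takeS w.1.2) eqseq_rcons -!andbA; congr (_ && _).
  by rewrite andbCA.
transitivity (pr J (fun w => [&& take i.+1 w.1.1 == take i.+1 x,
    take i.+1 w.1.2 == rcons (take i y) (tnth y i) & w.2 == v])).
  by apply: eq_bigl => w; rewrite splitE.
rewrite pr_step /pr.
rewrite [X in _ = X * _](partition_big (fun w => tnth w.1.2 i) xpredT)//=.
rewrite (_ : \sum_(b : Y) _ = noise_law Q v * seq_law (step_law v) [::] (zip (take i x) (take i y)) *
  p (take i x) (feedback jY jV (take i y) (take i v)) (tnth x i)).
  by rewrite !mulrA.
transitivity (\sum_b noise_law Q v * seq_law (step_law v) [::] (zip (take i x) (take i y)) *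
  (p (take i x) (feedback jY jV (take i y) (take i v)) (tnth x i) *
   W (take i.+1 x) (take i y) b)).
  apply: eq_bigr => b _; rewrite -pr_step; apply: eq_bigl => w; rewrite splitE.
  by rewrite -andbA; congr (_ && _); rewrite andbC.
rewrite -!mulr_sumr (W_channel _).2 ?mulr1//.
by rewrite size_takei takeS size_rcons size_takei.
Qed.

End Causality.

(** The causally conditioned probability p(y^n || x^n). *)
Definition output_density (x : n.-tuple X) (y : n.-tuple Y) : R :=
  \prod_(i < n) W (take i.+1 x) (take i y) (tnth y i).

Lemma joint_law_gt0 x y v : 0 < J (x, y, v) ->
  [/\ forall i : 'I_n, 0 < W (take i.+1 x) (take i y) (tnth y i) & 0 < noise_law Q v].
Proof.
move=> J0; have := gt_eqF J0; rewrite /joint_law /=.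
move/negbT/prodf_neq0 => nz; split=> [i|].
  have /= := nz i isT; rewrite !mulf_eq0 !negb_or => /andP[/andP[_ Wi _]].
  rewrite lt_neqAle eq_sym Wi/=; apply: (W_channel _).1.
  by rewrite !size_takel ?size_tuple// ltnW.
apply: prodr_gt0 => i _.
have /= := nz i isT; rewrite !mulf_eq0 !negb_or => /andP[_ Qi].
by rewrite lt_neqAle eq_sym Qi/=; exact: (Q_noise _).1.
Qed.

(** By causality the [i]-th density is ln W_i - (ln h(i+1) - ln h(i)), where h(m) is the probability
    of the first [m] outputs together with all of [v]. The sum telescopes between h(0), the noise
    law, and h(n). *)
Lemma directed_info_expect :
  directed_info jY jV W Q p n = \sum_w J w *
    ((ln (output_density w.1.1 w.1.2) + ln (noise_law Q w.2) -
      ln (pr J (fun w' => (w'.1.2 == w.1.2) && (w'.2 == w.2)))) / ln 2).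
Proof.
rewrite /directed_info; under eq_bigr do rewrite cond_mutual_info_expect.
rewrite exchange_big/=; apply: eq_bigr => -[[x y] v] _.
rewrite -mulr_sumr; have := joint_law_ge0 (x, y, v).
rewrite le_eqVlt => /predU1P[<-|Jw]; first by rewrite !mul0r.
have [W0 Q0] := joint_law_gt0 Jw.
congr (_ * _); rewrite /log2 -mulr_suml; congr (_ / _) => /=.
pose h m := pr J (fun w => (take m w.1.2 == take m y) && (w.2 == v)).
have h_gt0 m : 0 < h m.
  by apply: (pr_gt0 joint_law_ge0 Jw); rewrite /= !eqxx.
transitivity (\sum_(i < n) (ln (W (take i.+1 x) (take i y) (tnth y i)) - (ln (h i.+1) - ln (h i)))).
  apply: eq_bigr => i _; rewrite pr_joint_output_step.
  set a := pr _ _; set b := pr _ _; set c := pr _ _.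
  have -> : c = h i.+1.
    apply: eq_bigl => w; rewrite xpair_eqE -val_eqE/=.
    have tS (t : n.-tuple Y) : take i.+1 t = rcons (take i t) (tnth t i).
      by rewrite (take_nth (tnth t i)) ?size_tuple// -tnth_nth.
    by rewrite !tS eqseq_rcons andbCA andbA.
  have -> : b = h i by apply: eq_bigl => w; rewrite xpair_eqE -val_eqE.
  have a0 : 0 < a by apply: (pr_gt0 joint_law_ge0 Jw); rewrite /= !eqxx.
  rewrite opprB addrA -lnM ?posrE// -ln_div ?posrE// ?mulr_gt0//.
  by congr ln; field; rewrite !gt_eqF.
rewrite big_split/= sumrN.
have -> : \sum_(i < n) ln (W (take i.+1 x) (take i y) (tnth y i)) = ln (output_density x y).
  rewrite /output_density; apply: (can_inj (@expRK R)).
  rewrite expR_sum lnK ?posrE ?prodr_gt0//.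
  by apply: eq_bigr => i _; rewrite lnK ?posrE.
have -> : \sum_(i < n) (ln (h i.+1) - ln (h i)) = ln (h n) - ln (h 0).
  by rewrite -(big_mkord xpredT (fun i => ln (h i.+1) - ln (h i))) telescope_sumr.
have -> : h 0 = noise_law Q v.
  by rewrite -pr_joint_noise; apply: eq_bigl => w; rewrite !take0.
have -> : h n = pr J (fun w => (w.1.2 == y) && (w.2 == v)).
  by apply: eq_bigl => w; rewrite !take_oversize ?size_tuple// val_eqE.
ring.
Qed.

End JointLaw.

(** * Random code-functions *)

Section IndependentChoice.
Variables (R : realType) (D X : finType) (m : D -> X -> R).
Hypothesis m_pmf : forall d, is_pmf (m d).

Definition product_law (u : {ffun D -> X}) : R := \prod_d m d (u d).

Lemma product_law_pmf : is_pmf product_law.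
Proof.
split=> [u|]; first by apply: prodr_ge0 => d _; exact: (m_pmf d).1.
by rewrite -bigA_distr_bigA big1// => d _; exact: (m_pmf d).2.
Qed.

(** Injectivity of [k] means that distinct, hence independent, coordinates are read; the sum
    factorises over [D], and unread coordinates contribute 1. *)
Lemma product_law_marginal (I : finType) (k : I -> D) (x : I -> X) : injective k ->
  \sum_u product_law u * \prod_i (x i == u (k i))%:R = \prod_i m (k i) (x i).
Proof.
move=> k_inj; rewrite [RHS](partition_big k xpredT)//=.
transitivity (\sum_(u : {ffun D -> X}) \prod_d
    (m d (u d) * \prod_(i | k i == d) (x i == u d)%:R)).
  apply: eq_bigr => u _; rewrite big_split/=; congr (_ * _).
  rewrite (partition_big k xpredT)//=; apply: eq_bigr => d _.
  by apply: eq_bigr => i /eqP ->.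
rewrite -(bigA_distr_bigA (fun d a => m d a * \prod_(i | k i == d) (x i == a)%:R)).
apply: eq_bigr => d _; case: (pickP (fun i => k i == d)) => [i /eqP kd|kd].
  have kE j : (k j == d) = (j == i) by rewrite -kd (inj_eq k_inj).
  rewrite (big_pred1 i)// kd (bigD1 (x i))//= (big_pred1 i)// eqxx mulr1.
  rewrite big1 ?addr0// => a ax; rewrite (big_pred1 i)//.
  by rewrite eq_sym (negbTE ax) mulr0.
rewrite [RHS]big_pred0// -[RHS](m_pmf d).2; apply: eq_bigr => a _.
by rewrite big_pred0 //= mulr1.
Qed.

End IndependentChoice.

Local Arguments joint_law : simpl never.

Section RandomCodeFunction.
Variables (R : realType) (X Y V : finType) (G : zmodType).
Variables (jY : Y -> G) (jV : V -> G).
Variables (W : seq X -> seq Y -> Y -> R) (Q : seq V -> V -> R).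
Variable (p : seq X -> seq G -> X -> R).
Hypotheses (W_channel : is_channel W) (Q_noise : is_noise Q) (p_input : is_input p).
Variables (n : nat) (x0 : X).

Notation J := (@joint_law R X Y V G jY jV W Q p n).
Notation outcome := (n.-tuple X * n.-tuple Y * n.-tuple V)%type.

Lemma take_feedback i (ys : seq Y) (vs : seq V) :
  feedback jY jV (take i ys) (take i vs) = take i (feedback jY jV ys vs).
Proof.
elim: i ys vs => [|i IHi] [|y ys] [|v vs] //=.
by rewrite [LHS]/feedback/= -/(feedback _ _ _ _) IHi.
Qed.

(** [G] may be infinite; taking the image of a finite type keeps the set of histories, and hence the
    seed space, finite. *)
Definition history (iw : 'I_n * outcome) : seq X * seq G :=
  (take iw.1 iw.2.1.1, take iw.1 (feedback jY jV iw.2.1.2 iw.2.2)).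

(* A seed fixes in advance, independently for every history, the next input:
   the finitely many histories of length < n suffice. *)
Notation seed := {ffun seq_sub (codom history) -> X}.

Definition next_input (u : seed) (xs : seq X) (zs : seq G) : X :=
  if insub (xs, zs) is Some d then u d else x0.

(** Recomputes from the feedback the inputs that the seed has produced, since a code-function is not
    given them. *)
Fixpoint past_inputs (u : seed) (k : nat) (zs : seq G) : seq X :=
  if k is k'.+1 then
    rcons (past_inputs u k' zs) (next_input u (past_inputs u k' zs) (take k' zs))
  else [::].

Definition seed_fun (u : seed) (zs : seq G) : X :=
  next_input u (past_inputs u (size zs) zs) zs.

Definition seed_law : seed -> R :=
  product_law (fun d : seq_sub (codom history) => p (val d).1 (val d).2).

Lemma past_inputs_take u k m zs : (k <= m)%N ->
  past_inputs u k (take m zs) = past_inputs u k zs.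
Proof. by elim: k => //= k IHk km; rewrite IHk 1?ltnW// take_takel// ltnW. Qed.

Lemma history_pmf (d : seq_sub (codom history)) : is_pmf (p (val d).1 (val d).2).
Proof.
apply: p_input; have /codomP[[i [[x y] v]] ->] := valP d.
by rewrite /history/= !size_tuple.
Qed.

Lemma seed_law_pmf : is_pmf seed_law.
Proof. exact/product_law_pmf/history_pmf. Qed.

Lemma prodr_nat_bool (I : finType) (b : I -> bool) :
  \prod_i (b i)%:R = ([forall i, b i])%:R :> R.
Proof.
case: (boolP [forall i, b i]) => [/forallP bi|/forallPn[i bi]].
  by rewrite big1// => i _; rewrite bi.
by rewrite (bigD1 i)//= (negbTE bi) mul0r.
Qed.

(** By induction on time, recomputed and actual inputs agree along any path satisfying either
    condition. *)
Lemma seed_fun_path u (x : n.-tuple X) (zs : seq G) : size zs = n ->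
  [forall i : 'I_n, tnth x i == seed_fun u (take i zs)] =
  [forall i : 'I_n, tnth x i == next_input u (take i x) (take i zs)].
Proof.
move=> zn.
have step k : (k < n)%N -> (forall i : 'I_n, (i < k)%N ->
    tnth x i = next_input u (past_inputs u i zs) (take i zs)) ->
  past_inputs u k zs = take k x.
  elim: k => [|k IHk] kn H; first by rewrite take0.
  have kn' : (k < n)%N by exact: ltnW.
  have IH : past_inputs u k zs = take k x.
    by apply: IHk => // i ik; apply: H; rewrite ltnW.
  rewrite /= (take_nth x0) ?size_tuple//; have := H (Ordinal kn') (ltnSn k).
  by rewrite (tnth_nth x0)/= => <-; rewrite IH.
have seedE (i : 'I_n) : seed_fun u (take i zs) =
    next_input u (past_inputs u i zs) (take i zs).
  by rewrite /seed_fun size_takel ?zn 1?ltnW// past_inputs_take.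
apply/forallP/forallP => H i; have /eqP Hi := H i.
  rewrite -(step i)// -?seedE ?Hi// => j _.
  by have /eqP -> := H j; rewrite seedE.
suff E k : (k < n)%N -> past_inputs u k zs = take k x by rewrite Hi seedE E.
move=> kn; elim: k kn => [|k IHk] kn; first by rewrite take0.
have kn' : (k < n)%N by exact: ltnW.
rewrite /= (take_nth x0) ?size_tuple// IHk//.
by have /eqP := H (Ordinal kn'); rewrite (tnth_nth x0)/= => <-.
Qed.

Notation K u := (@joint_law R X Y V G jY jV W Q (input_of_code_fun R (seed_fun u)) n).

Lemma code_fun_input (f : seq G -> X) : is_input (input_of_code_fun R f).
Proof.
move=> xs zs _; split=> [x|]; first exact: ler0n.
rewrite /input_of_code_fun (bigD1 (f zs))//= eqxx big1 ?addr0// => x.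
by move/negbTE ->.
Qed.

Lemma joint_law_seed u (x : n.-tuple X) (y : n.-tuple Y) (v : n.-tuple V) :
  K u (x, y, v) =
  [forall i : 'I_n, tnth x i ==
     next_input u (take i x) (take i (feedback jY jV y v))]%:R *
  (output_density W x y * noise_law Q v).
Proof.
rewrite -seed_fun_path ?size_feedback ?size_tuple ?minnn// -prodr_nat_bool.
rewrite /output_density /noise_law -!big_split/=; apply: eq_bigr => i _.
by rewrite /input_of_code_fun take_feedback mulrA.
Qed.

(** The histories met along one outcome have different lengths, so they are distinct coordinates of
    the seed. Their choices are therefore independent, and averaging turns the indicators into the
    product of the [p] factors. *)
Lemma joint_law_mixture w : \sum_u seed_law u * K u w = J w.
Proof.
case: w => [[x y] v]; under eq_bigr do rewrite joint_law_seed mulrA.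
rewrite -mulr_suml.
pose k i : seq_sub (codom history) := SeqSub (codom_f history (i, (x, y, v))).
have k_inj : injective k.
  move=> i j /(congr1 (fun d => size (val d).1)) /=.
  by rewrite !size_takel ?size_tuple 1?ltnW// => /val_inj.
transitivity ((\prod_i p (val (k i)).1 (val (k i)).2 (tnth x i)) *
    (output_density W x y * noise_law Q v)).
  congr (_ * _); rewrite -(product_law_marginal history_pmf _ k_inj).
  apply: eq_bigr => u _; congr (_ * _); rewrite -prodr_nat_bool.
  apply: eq_bigr => i _; congr (_ == _)%:R.
  by rewrite /next_input -[(_, _)]/(val (k i)) valK.
rewrite /joint_law /output_density /noise_law -!big_split/=.
by apply: eq_bigr => i _; rewrite take_feedback mulrA.
Qed.

Definition seed_channel (u : seed) (y : n.-tuple Y) : R :=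
  pr (K u) (fun w => w.1.2 == y).

Lemma seed_channel_pmf u : is_pmf (seed_channel u).
Proof.
have Kp := joint_law_pmf jY jV W_channel Q_noise (code_fun_input (seed_fun u)) n.
split=> [y|]; first by apply: pr_ge0; exact: Kp.1.
by rewrite sum_pr Kp.2.
Qed.

Lemma output_seed y : output seed_law seed_channel y = pr J (fun w => w.1.2 == y).
Proof.
rewrite /output /seed_channel /pr; under eq_bigr do rewrite mulr_sumr.
by rewrite exchange_big/=; apply: eq_bigr => w _; rewrite joint_law_mixture.
Qed.

(* [log P(y|x) Q(v) / P(y, v)] has mean [directed_info]; dropping [v] from the
   denominator costs [H(V|Y) <= H(V)], and [P(y|x) Q(v)] is at most the
   probability of [y] given the seed. *)
Lemma directed_info_le_seed_info :
  ln 2 * (directed_info jY jV W Q p n - entropy (@noise_law R V Q n)) <=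
  \sum_u seed_law u * \sum_y seed_channel u y *
    ln (seed_channel u y / output seed_law seed_channel y).
Proof.
have J0 := joint_law_ge0 jY jV W_channel Q_noise p_input (n := n).
pose PY (y : n.-tuple Y) := pr J (fun w => w.1.2 == y).
pose PYV (yv : n.-tuple Y * n.-tuple V) := pr J (fun w => (w.1.2, w.2) == yv).
pose q (yv : n.-tuple Y * n.-tuple V) := PY yv.1 * noise_law Q yv.2.
pose A (w : outcome) := ln (output_density W w.1.1 w.1.2 * noise_law Q w.2 / PY w.1.2).
have L0 := ln2_gt0 R.
have entE : ln 2 * entropy (@noise_law R V Q n) = - \sum_w J w * ln (noise_law Q w.2).
  rewrite (sum_pr_fiber J (fun w => w.2) (fun v => ln (noise_law Q v))).
  rewrite /entropy mulrN mulr_sumr; congr (- _); apply: eq_bigr => v _.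
  by rewrite pr_joint_noise// /log2; field; rewrite gt_eqF.
have PY0 w : 0 < J w -> 0 < PY w.1.2 by move=> Jw; apply: (pr_gt0 J0 Jw); rewrite /= eqxx.
(* As [q] is the product of the two marginals of [PYV], the second sum is - I(Y^n; V^n) in nats. *)
have split : ln 2 * (directed_info jY jV W Q p n - entropy (@noise_law R V Q n)) =
    \sum_w J w * A w + \sum_yv PYV yv * ln (q yv / PYV yv).
  rewrite mulrBr entE opprK directed_info_expect// mulr_sumr.
  rewrite -(sum_pr_fiber J (fun w => (w.1.2, w.2)) (fun yv => ln (q yv / PYV yv))).
  rewrite -!big_split/=; apply: eq_bigr => -[[x y] v] _ /=.
  have := J0 (x, y, v); rewrite le_eqVlt => /predU1P[<-|Jw].
    by rewrite !mul0r mulr0.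
  have [W0 Q0] := joint_law_gt0 W_channel Q_noise Jw.
  have D0 : 0 < output_density W x y by apply: prodr_gt0.
  have PYw : 0 < PY y := PY0 _ Jw.
  have PYVw : 0 < PYV (y, v) by apply: (pr_gt0 J0 Jw); rewrite /= eqxx.
  have -> : pr J (fun w' => (w'.1.2 == y) && (w'.2 == v)) = PYV (y, v).
    by apply: eq_bigl => w; rewrite xpair_eqE.
  rewrite /A /q /= !ln_div ?posrE ?mulr_gt0// !lnM ?posrE//.
  by field; rewrite gt_eqF.
have gibbs : \sum_yv PYV yv * ln (q yv / PYV yv) <= 0.
  apply: sum_mul_ln_ratio_le0.
  - by move=> yv; exact: pr_ge0.
  - move=> yv; rewrite mulr_ge0 ?pr_ge0//.
    exact: (noise_law_pmf Q_noise n).1.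
  - move=> [y v]; rewrite {1}/PYV /pr => h.
    have [w] : exists w, (w.1.2, w.2) == (y, v) /\ 0 < J w.
      apply: contrapT => /forallNP nw; move: h; rewrite big1 ?ltxx// => w wE.
      have := J0 w; rewrite le_eqVlt => /predU1P[//|Jw]; case: (nw w); by split.
    move=> [/eqP[<- <-]] Jw; rewrite mulr_gt0 ?PY0//.
    by case: w Jw => [[? ?] ?] /(joint_law_gt0 W_channel Q_noise)[].
  - rewrite sum_pr joint_law_sum1// -(pair_bigA _ (fun y v => q (y, v)))/=.
    under eq_bigr do rewrite /q /= -mulr_sumr (noise_law_pmf Q_noise n).2 mulr1.
    by rewrite sum_pr joint_law_sum1.
rewrite split; apply: (@le_trans _ _ (\sum_w J w * A w)).
  by rewrite -[leRHS]addr0 lerD2l.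
under eq_bigr do rewrite -joint_law_mixture mulr_suml.
rewrite exchange_big/=; apply: ler_sum => u _.
under eq_bigr do rewrite -mulrA; rewrite -mulr_sumr.
have := seed_law_pmf.1 u; rewrite le_eqVlt => /predU1P[<-|u0].
  by rewrite !mul0r.
rewrite ler_pM2l//.
rewrite -(sum_pr_fiber (K u) (fun w => w.1.2) (fun y =>
  ln (seed_channel u y / output seed_law seed_channel y))).
apply: ler_sum => -[[x y] v] _ /=.
have K0 := joint_law_ge0 jY jV W_channel Q_noise (code_fun_input (seed_fun u)) (n := n).
have := K0 (x, y, v); rewrite le_eqVlt => /predU1P[<-|Kw]; first by rewrite !mul0r.
have Jw : 0 < J (x, y, v).
  rewrite -joint_law_mixture (bigD1 u)//= ltr_pwDl ?mulr_gt0//.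
  apply: sumr_ge0 => u' _; rewrite mulr_ge0 ?seed_law_pmf.1//.
  exact: (joint_law_ge0 _ _ _ _ (code_fun_input _)).
have PYw : 0 < PY y := PY0 _ Jw.
have KE : K u (x, y, v) = output_density W x y * noise_law Q v.
  move: Kw; rewrite joint_law_seed; case: [forall _, _]; last by rewrite mul0r ltxx.
  by rewrite mul1r.
have Kk : K u (x, y, v) <= seed_channel u y.
  rewrite /seed_channel /pr (bigD1 (x, y, v))//= lerDl sumr_ge0// => w _; exact: K0.
rewrite ler_pM2l// output_seed -/(PY y) /A /= -KE ler_ln ?posrE ?divr_gt0//.
  by rewrite ler_pM2r ?invr_gt0.
exact: lt_le_trans Kk.
Qed.

End RandomCodeFunction.

(** * Codes against the strong converse *)

Section LimitBounds.
Variable R : realType.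
Implicit Types (u : (\bar R)^nat) (r : R).
Local Open Scope ereal_scope.

Lemma near_limn_esup_lt u r : limn_esup u < r%:E -> \forall n \near \oo, u n < r%:E.
Proof.
move=> /ereal_inf_lt[_ [A Aoo <-] supA]; apply: filterS Aoo => n An.
by apply: le_lt_trans supA; apply: ereal_sup_ubound; exists n.
Qed.

Lemma near_limn_einf_gt u r : r%:E < limn_einf u -> \forall n \near \oo, r%:E < u n.
Proof.
rewrite /limn_einf lteNr => /near_limn_esup_lt.
by apply: filterS => n /=; rewrite EFinN lteN2.
Qed.

Lemma limn_einf_ge_near u r : (\forall n \near \oo, r%:E <= u n) -> r%:E <= limn_einf u.
Proof.
move=> ru; rewrite /limn_einf leeNr; apply: ge_ereal_inf.
exists (ereal_sup ((\- u) @` [set n | r%:E <= u n])).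
  by exists [set n | r%:E <= u n].
by apply: ge_ereal_sup => _ [n /= rn <-]; rewrite EFinN leeN2.
Qed.

Lemma limn_esup_ge0 u : (forall n, 0 <= u n) -> 0 <= limn_esup u.
Proof.
move=> u0; apply: le_ereal_inf_tmp => _ [A Aoo <-].
have [n An] := filter_ex Aoo.
by apply: (le_trans (u0 n)); apply: ereal_sup_ubound; exists n.
Qed.

End LimitBounds.

Lemma entropy_ge0 (R : realType) (T : finType) (P : T -> R) : is_pmf P -> 0 <= entropy P.
Proof.
move=> [P0 P1]; rewrite /entropy oppr_ge0; apply: sumr_le0 => t _.
rewrite /log2 mulrA pmulr_lle0 ?invr_gt0 ?ln2_gt0// mulr_ge0_le0// ln_le0//.
by rewrite -P1 (bigD1 t)//= lerDl sumr_ge0.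
Qed.

(** The case [N = 0] rests on the convention [ln 0 = 0]. *)
Lemma ln_natX (R : realType) (N n : nat) : ln (N ^ n)%:R = n%:R * ln N%:R :> R.
Proof.
case: N => [|N]; last by rewrite natrX lnXn// mulr_natl.
by rewrite [RHS]mulrC [ln 0](ln0 (lexx _)) mul0r; case: n => [|n]; rewrite ?ln1// exp0n// ln0.
Qed.

Section CodeExistence.
Variables (R : realType) (X Y V : finType) (G : zmodType).
Variables (jY : Y -> G) (jV : V -> G).
Variables (W : seq X -> seq Y -> Y -> R) (Q : seq V -> V -> R).
Hypotheses (W_channel : is_channel W) (Q_noise : is_noise Q).
Variable x0 : X.

(** A code with a single message has rate 0 and never errs. *)
Lemma capacity_ge0 : (0 <= capacity jY jV W Q)%E.
Proof.
apply: ereal_sup_ubound; exists 0 => //; split=> // eps /andP[eps0 _].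
apply: nearW => n.
exists 1%N, (Code (fun=> fun=> x0) (fun=> ord0)); split; last first.
  by rewrite /log2 ln1 !mul0r; lra.
by rewrite /avg_error big_ord1 /pr big_pred0 ?mulr0 ?ltW//.
Qed.

Section FixedInput.
Variables (p : seq X -> seq G -> X -> R) (p_input : is_input p).

Notation dense_probability n T :=
  (pr_dense (seed_law (jY := jY) (jV := jV) (n := n) p) (seed_channel W Q x0) T).

Lemma dense_avg_error n m T b : 0 < T -> m.+1%:R / T + b <= dense_probability n T ->
  exists c : Defs.code X Y G n m.+1, avg_error jY jV W Q c <= 1 - b.
Proof.
move=> T0 /(dense_code (seed_law_pmf jY jV p_input n) (seed_channel_pmf W_channel Q_noise x0) T0).
move=> [s [g [_ sb]]].
(* [inord] sends unclaimed outputs to an arbitrary message, which can only enlarge a decoding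
   region. *)
exists (Code (fun i : 'I_m.+1 => seed_fun x0 (s i)) (fun y => inord (g y))).
rewrite /avg_error ler_pdivrMl ?ltr0n//.
apply: (@le_trans _ _ (\sum_(i < m.+1) (1 - b))); last first.
  by rewrite sumr_const card_ord mulr_natl.
apply: ler_sum => i _; set K := @joint_law R X Y V G jY jV W Q _ n.
have Kp : is_pmf K := joint_law_pmf _ _ W_channel Q_noise (code_fun_input R _) n.
have sbi := sb i (ltn_ord i); rewrite -(pr_preim K (fun w => w.1.2)) in sbi.
have hit : b <= pr K (fun w => inord (g w.1.2) == i).
  apply: (le_trans sbi); apply: pr_le; first exact: Kp.1.
  by move=> w /eqP ->; rewrite inord_val.
rewrite -[leLHS]/(pr K (fun w => inord (g w.1.2) != i)) -Kp.2.
rewrite (bigID (fun w => inord (g w.1.2) == i))/= -/(pr K _) -/(pr K _).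
by rewrite addrAC lerDr subr_ge0.
Qed.

(** The threshold is [T = 2^(n(r+d))]. The excess [n * d * L] of the information over [ln T] is at
    most [P * n * ln #|Y| + 1], and [2 <= n * d * L] absorbs the 1, so [P >= 2 * b]. One [b] pays
    for [m.+1 / T], the other is the success probability. The summand [L] in [b] keeps its
    denominator positive when [ln #|Y|] is 0. *)
Lemma rate_code n (r d : R) :
  let L := ln 2 in
  let b := d * L / (4 * (ln #|Y|%:R + L)) in
  0 <= r -> 0 < d -> 2 <= n%:R * (d * L) -> 2 / b <= n%:R * (d * L) ->
  n%:R * (r + 2 * d) <= directed_info jY jV W Q p n - entropy (@noise_law R V Q n) ->
  exists M (c : Defs.code X Y G n M),
    n%:R * r <= log2 M%:R /\ avg_error jY jV W Q c <= 1 - b.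
Proof.
move=> L b r0 d0 n2 nb info; have L0 : 0 < L := ln2_gt0 R.
have Y0 : 0 <= ln #|Y|%:R :> R.
  by case: #|Y| => [|N]; [rewrite ln0|rewrite ln_ge0// ler1n].
have b0 : 0 < b by rewrite divr_gt0 ?mulr_gt0// ltr_wpDl.
have n0 : 0 < n%:R :> R by rewrite ltNge; apply/negP => n0; have := mulr_gt0 d0 L0; nra.
pose T := expR (n%:R * (r + d) * L).
have T1 : 1 <= T.
  have := expR_ge1Dx (n%:R * (r + d) * L); apply: le_trans.
  by rewrite lerDl !mulr_ge0// ?addr_ge0// ltW.
have T0 : 0 < T by exact: expR_gt0.
set P := dense_probability n T.
have Pb : 2 * b <= P.
  have := mutual_info_le (seed_law_pmf jY jV p_input n) (seed_channel_pmf W_channel Q_noise x0) T1.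
  rewrite -/P expRK card_tuple ln_natX.
  move/(le_trans (directed_info_le_seed_info jY jV W_channel Q_noise p_input n x0)).
  rewrite -/L => h; have := ler_wpM2l (ltW L0) info => h'.
  have P0 : 0 <= P by apply: pr_dense_ge0; [exact: seed_law_pmf|exact: seed_channel_pmf].
  have -> : 2 * b = d * L / (2 * (ln #|Y|%:R + L)).
    by rewrite /b; field; rewrite gt_eqF// ltr_wpDl.
  rewrite ler_pdivrMr ?mulr_gt0// ?ltr_wpDl//.
  have {}h : n%:R * (d * L) <= n%:R * (P * ln #|Y|%:R) + 1 by lra.
  have : n%:R * (d * L) <= n%:R * (P * (2 * ln #|Y|%:R)) by lra.
  rewrite ler_pM2l// => /le_trans; apply; rewrite ler_wpM2l//; lra.
pose e := expR (n%:R * r * L).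
have e1 : 1 <= e.
  have := expR_ge1Dx (n%:R * r * L); apply: le_trans.
  by rewrite lerDl !mulr_ge0// ltW.
pose m := Num.truncn e.
have em : e < m.+1%:R by exact: truncnS_gt.
have me : m.+1%:R <= 2 * e.
  have : m%:R <= e by rewrite truncn_le// ltW// expR_gt0.
  by rewrite -natr1; lra.
have [c cb] : exists c : Defs.code X Y G n m.+1, avg_error jY jV W Q c <= 1 - b.
  apply: (dense_avg_error T0); rewrite -/P.
  suff : m.+1%:R / T <= b by lra.
  (* Here [m.+1 / T <= 2 / expR (n * d * L)], and the exponential exceeds [n * d * L >= 2 / b]. *)
  rewrite ler_pdivrMr// (le_trans me)// mulrC.
  have -> : T = e * expR (n%:R * (d * L)) by rewrite -expRD; congr expR; ring.
  rewrite mulrCA ler_pM2l ?expR_gt0// mulrC -ler_pdivrMr//.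
  by apply: (le_trans nb); have := expR_ge1Dx (n%:R * (d * L)); lra.
exists m.+1, c; split=> //.
rewrite /log2 ler_pdivlMr// -[leLHS]expRK ler_ln ?posrE ?expR_gt0//; exact: ltW.
Qed.

Hypothesis W_strong_converse : strong_converse jY jV W Q.

Lemma strong_converse_info_le (C h : R) :
  capacity jY jV W Q = C%:E -> noise_entropy_rate Q = h%:E ->
  (limn_einf (fun n => (n%:R^-1 * directed_info jY jV W Q p n)%:E) <= (C + h)%:E)%E.
Proof.
move=> CE hE; rewrite leNgt; apply/negP => gap.
have C0 : 0 <= C by rewrite -lee_fin -CE capacity_ge0.
(* Of the margin [4 * d], one [d] bounds the excess of the noise entropy over [h], one raises the
   rate to [C + d], and two are spent in [rate_code]. Dividing by 5 keeps the inequality strict. *)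
have [d d0 /near_limn_einf_gt DI] : exists2 d : R, 0 < d &
    ((C + h + 4 * d)%:E < limn_einf (fun n => (n%:R^-1 * directed_info jY jV W Q p n)%:E))%E.
  move: gap; case: (limn_einf _) => [l||]//.
  - rewrite lte_fin => gap; exists ((l - C - h) / 5); first by lra.
    by rewrite lte_fin; lra.
  - by move=> _; exists 1 => //; rewrite ltry.
have /near_limn_esup_lt H : (noise_entropy_rate Q < (h + d)%:E)%E.
  by rewrite hE lte_fin ltrDl.
pose L : R := ln 2.
pose b := d * L / (4 * (ln #|Y|%:R + L)).
have L0 : 0 < L := ln2_gt0 R.
have Y0 : 0 <= ln #|Y|%:R :> R.
  by case: #|Y| => [|N]; [rewrite ln0|rewrite ln_ge0// ler1n].
have b0 : 0 < b by rewrite divr_gt0 ?mulr_gt0// ltr_wpDl.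
have dL : 0 < d * L by rewrite mulr_gt0.
pose good_code n (Mc : {M & Defs.code X Y G n M}) :=
  C + d <= n%:R^-1 * log2 (projT1 Mc)%:R /\
  avg_error jY jV W Q (projT2 Mc) <= 1 - b.
have good : \forall n \near \oo, exists Mc, good_code n Mc.
  near=> n.
  have nn : 2 / (d * L) <= n%:R by near: n; exact: nbhs_infty_ger.
  have nb : 2 / b / (d * L) <= n%:R by near: n; exact: nbhs_infty_ger.
  have n0 : 0 < n%:R :> R by rewrite (lt_le_trans _ nn)// divr_gt0.
  have DIn : C + h + 4 * d < n%:R^-1 * directed_info jY jV W Q p n.
    by rewrite -lte_fin; near: n.
  have Hn : n%:R^-1 * entropy (@noise_law R V Q n) < h + d.
    by rewrite -lte_fin; near: n.
  have [|||||M [c [cr ce]]] := @rate_code n (C + d) d.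
  - by rewrite addr_ge0// ltW.
  - by [].
  - by rewrite -ler_pdivrMr.
  - by rewrite -ler_pdivrMr.
  - move: DIn Hn; rewrite !(mulrC n%:R^-1) ltr_pdivlMr// ltr_pdivrMr//; lra.
  exists (existT _ M c); split=> //=.
  by rewrite mulrC ler_pdivlMr// mulrC.
(* The strong converse wants a code at every [n]; the one-message filler occurs only finitely often
   and affects no limit. *)
pose codes n : {M & Defs.code X Y G n M} :=
  if pselect (exists Mc, good_code n Mc) is left ex then sval (cid ex)
  else existT _ 1%N (Code (fun=> fun=> x0) (fun=> ord0)).
have codesP : \forall n \near \oo, good_code n (codes n).
  apply: filterS good => n ex; rewrite /codes; case: pselect => // ex'.
  by case: cid.
have rate : ((C + d)%:E <=
    limn_einf (fun n => (n%:R^-1 * log2 (projT1 (codes n))%:R)%:E))%E.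
  by apply: limn_einf_ge_near; apply: filterS codesP => n [? _]; rewrite lee_fin.
have capd : (capacity jY jV W Q < (C + d)%:E)%E by rewrite CE lte_fin ltrDl.
have err1 := @W_strong_converse _ capd _ (fun n => projT2 (codes n)) rate.
have err_gt : \forall n \near \oo, 1 - b < avg_error jY jV W Q (projT2 (codes n)).
  by apply: (cvgr_gt _ err1); rewrite gtrBl.
have [n [[_ le_b] gt_b]] := filter_ex (filterI codesP err_gt).
by move: gt_b; rewrite ltNge le_b.
Unshelve. all: by end_near. Qed.

End FixedInput.

End CodeExistence.

Theorem theorem7 (R : realType) (X Y V : finType) (G : zmodType)
    (jY : Y -> G) (jV : V -> G) (jY_inj : injective jY) (jV_inj : injective jV)
    (W : seq X -> seq Y -> Y -> R) (Q : seq V -> V -> R)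
    (W_channel : is_channel W) (Q_noise : is_noise Q)
    (W_strong_converse : strong_converse jY jV W Q) :
  (capacity_bar jY jV W Q - noise_entropy_rate Q <= capacity jY jV W Q)%E.
Proof.
have h0 : (0 <= noise_entropy_rate Q)%E.
  apply: limn_esup_ge0 => n; rewrite lee_fin mulr_ge0 ?invr_ge0//.
  exact/entropy_ge0/noise_law_pmf.
(* Code construction needs a letter of [X]. With [X] empty there is no input law, and the supremum
   is that of the empty set. *)
have input_inhabited (p : seq X -> seq G -> X -> R) : is_input p -> X.
  move=> p_input; case: (pickP (@predT X)) => [x //|X0].
  have /eqP := (p_input [::] [::] erefl).2.
  by rewrite big_pred0 // eq_sym oner_eq0.
(* If the entropy rate is [+oo], the left-hand side is [-oo], by convention even when [capacity_bar]
   is [+oo]. *)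
case hE : (noise_entropy_rate Q) h0 => [h||] // h0; last by rewrite /= addeNy leNye.
rewrite leeBlDr//; apply: ge_ereal_sup => _ [p p_input <-].
have x0 := input_inhabited p p_input.
have C0 := capacity_ge0 jY jV W Q x0.
case CE : (capacity jY jV W Q) C0 => [C||] // _; last by rewrite leey.
rewrite -EFinD; exact: (strong_converse_info_le W_channel Q_noise x0).
Qed.
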